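(* Let $\mathbf{K}$ be a field of characteristic $0$. Any identity satisfied by the anti-commutator product in every bicommutative algebra over $\mathbf{K}$ is a consequence of the three identities $$\{a,b\}=\{b,a\},$$ $$\{\{a,b\},\{c,d\}\}-\{\{a,d\},\{c,b\}\}=-\{(a,b,c),d\}+\{(a,d,c),b\},$$ $$\{\{\{a,b\},c\},d\}=\{\{\{a,b\},d\},c\},$$ where $(a,b,c)=\{a,\{b,c\}\}-\{\{a,b\},c\}$ (commutativity, the minus-Tortken identity and the weak right-commutativity identity). That is, if a nonassociative polynomial $f$ in one binary operation vanishes identically on $A^{(+)}$ for every bicommutative algebra $A$ over $\mathbf{K}$, then $f$ vanishes identically on every $\mathbf{K}$-algebra whose product $\{\cdot,\cdot\}$ satisfies the three identities above.
   Context: All algebras are (not necessarily associative, not necessarily unital) algebras over $\mathbf{K}$. An algebra is called bicommutative if it satisfies the identities $a(bc)=b(ac)$ and $(ab)c=(ac)b$. For an algebra $A$, the anti-commutator algebra $A^{(+)}$ is the vector space $A$ with the product $\{x,y\}=xy+yx$. An identity is an equation $f=0$ with $f$ an element of the free nonassociative algebra over $\mathbf{K}$ on countably many variables; it is satisfied by an algebra if $f$ evaluates to $0$ under every substitution of elements of the algebra. *)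

(* Defs.v *)
From HB Require Import structures.
From mathcomp Require Import all_boot all_order all_algebra.
From mathcomp.multinomials Require Import freeg.

Set Implicit Arguments.
Unset Strict Implicit.
Unset Printing Implicit Defensive.

Import GRing.Theory.
Local Open Scope ring_scope.

(* A (not necessarily associative or unital) K-algebra is an lmodType K       *)
(* together with a product mul : {bilinear A -> A -> A}; MathComp's own       *)
(* algebra structures are all associative and unital. The definitions below   *)
(* only use the underlying operation A -> A -> A.                             *)

(* Nonassociative monomials, i.e. the free magma on countably many variables. *)
Inductive monomial : Type :=
  | Var of nat
  | Mul of monomial & monomial.

Fixpoint monomial_encode (m : monomial) : GenTree.tree nat :=
  match m with
  | Var i => GenTree.Leaf i
  | Mul m1 m2 => GenTree.Node 0 [:: monomial_encode m1; monomial_encode m2]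
  end.

Fixpoint monomial_decode (t : GenTree.tree nat) : option monomial :=
  match t with
  | GenTree.Leaf i => Some (Var i)
  | GenTree.Node 0 [:: t1; t2] =>
      match monomial_decode t1, monomial_decode t2 with
      | Some m1, Some m2 => Some (Mul m1 m2)
      | _, _ => None
      end
  | _ => None
  end.

Lemma monomial_encodeK : pcancel monomial_encode monomial_decode.
Proof. by elim=> [i|m1 IH1 m2 IH2] //=; rewrite IH1 IH2. Qed.

HB.instance Definition _ := Countable.copy monomial (pcan_type monomial_encodeK).

(* The vector space underlying the free nonassociative algebra over K: finite *)
(* K-linear combinations of nonassociative monomials.                         *)
Definition napoly (K : fieldType) := {freeg monomial / K}.

Section Identities.
Variables (K : fieldType) (A : lmodType K) (op : A -> A -> A).

Fixpoint eval_monomial (v : nat -> A) (m : monomial) : A :=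
  match m with
  | Var i => v i
  | Mul m1 m2 => op (eval_monomial v m1) (eval_monomial v m2)
  end.

(* fglift is the linear extension of a map defined on the basis. *)
Definition eval_napoly (v : nat -> A) (f : napoly K) : A :=
  fglift (eval_monomial v) f.

Definition satisfies (f : napoly K) : Prop :=
  forall v : nat -> A, eval_napoly v f = 0.

Definition bicommutative : Prop :=
  (forall a b c, op a (op b c) = op b (op a c)) /\
  (forall a b c, op (op a b) c = op (op a c) b).

Definition anticommutator (x y : A) : A := op x y + op y x.

(* The sign is opposite to that of the usual associator. *)
Definition assoc (a b c : A) : A := op a (op b c) - op (op a b) c.

Definition minus_tortken : Prop := forall a b c d,
  op (op a b) (op c d) - op (op a d) (op c b) =
  - op (assoc a b c) d + op (assoc a d c) b.

Definition weak_right_commutative : Prop := forall a b c d,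
  op (op (op a b) c) d = op (op (op a b) d) c.

End Identities.

(* Main.v *)
Require Import Defs.
From HB Require Import structures.
From mathcomp Require Import all_boot all_order all_algebra.
From mathcomp Require Import ring.
From mathcomp.finmap Require Import finmap.
From mathcomp.multinomials Require Import freeg monalg.

(* For a commutative algebra P the product                                    *)
(*   (t, d) (t', d') = ((t + d) (t' - d') / 2, 0)                             *)
(* on P * P is bicommutative and {(t, d), (t', d')} = (t t' - d d', 0). Take  *)
(* P to be the polynomial ring in variables t_i, d_i and evaluate at          *)
(* x_i = (t_i, d_i).                                                          *)
(*   Conversely let B satisfy the three identities, let v_i be elements of B, *)
(* and write T_i for the multiplication by v_i. By weak right-commutativity   *)
(* B^2 is associative and all multiplications commute on it. The operators    *)
(* D_ij = T_i T_j - (v_i v_j) on B^2 satisfy D_ij D_kl = D_ik D_jl, which is  *)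
(* the minus-Tortken identity: they behave like products d_i d_j of commuting *)
(* variables. Hence there is a linear map psi from P to B with                *)
(*   psi (t^a d^J) = T^a (D^J - T^J)  (|J| even)   and   psi (d_i) = v_i      *)
(* that sends the value of a monomial at (t_i, d_i) to its value at (v_i).    *)
(* Thus an identity of the first algebra is an identity of B.                 *)

Set Implicit Arguments.
Unset Strict Implicit.
Unset Printing Implicit Defensive.

Import GRing.Theory.
Local Open Scope ring_scope.

(** The existence of psi rests on D^J not depending on the order of J ([perm_dcorr]): D_ij = D_ji
    follows from commutativity, and exchanging letters across two pairs is the minus-Tortken
    identity ([tortken_termAC]). That psi carries values to values ([psi_eval]) is proved by
    induction on monomials with the stronger invariant [represents], which describes psi on the
    ideal generated by the value of a product. *)

(** * Induction principles for lists *)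

Lemma perm_eq_ind (T : eqType) (R : seq T -> seq T -> Prop) :
  (forall s, R s s) ->
  (forall s1 s2 s3, R s1 s2 -> R s2 s3 -> R s1 s3) ->
  (forall x s1 s2, perm_eq s1 s2 -> R s1 s2 -> R (x :: s1) (x :: s2)) ->
  (forall x y s, R (x :: y :: s) (y :: x :: s)) ->
  forall s1 s2, perm_eq s1 s2 -> R s1 s2.
Proof.
move=> Rxx Rtr Rcons Rswap; elim=> [|x s1 IH] s2 s12.
  by move/perm_size: (s12) => /esym/size0nil->.
have x_s2 : x \in s2 by rewrite -(perm_mem s12) mem_head.
have Rrem : R (x :: rem x s2) s2.
  move: x_s2 {s12}; elim: s2 => // y s IHs; rewrite inE /=.
  have [-> //|_] /= := eqVneq y x => xs.
  apply: Rtr (Rswap _ _ _) _; apply: Rcons (IHs xs).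
  by rewrite perm_sym perm_to_rem.
apply: Rtr Rrem; apply: Rcons; last apply: IH;
  by rewrite -(perm_cons x) (perm_trans s12) // perm_to_rem.
Qed.

(** Matches the recursion of [dcorr], which removes two letters at a time. *)
Lemma seq_pair_ind (T : Type) (P : seq T -> Prop) :
  P [::] -> (forall x, P [:: x]) ->
  (forall x y s, P s -> P (x :: y :: s)) -> forall s, P s.
Proof.
move=> P0 P1 P2 s; elim: {s}(size s).+1 {-2}s (ltnSn (size s)) => //= n IH.
by case=> [|x [|y s]] //= sz; apply/P2/IH/ltnW.
Qed.

(** * Linear maps out of a polynomial ring *)

Section MonomialFunctional.
Variables (K : fieldType) (I : choiceType) (V : lmodType K).

Local Notation poly_ring := {malg K[{cmonom I}]}.

Definition malg_lift (G : {cmonom I} -> V) (q : poly_ring) : V :=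
  \sum_(k <- msupp q) mcoeff k q *: G k.

Lemma malg_liftEw G (d : {fset {cmonom I}}) q :
  (msupp q `<=` d)%fset -> malg_lift G q = \sum_(k <- d) mcoeff k q *: G k.
Proof.
move=> le_d; apply: big_fset_incl => // k _ /mcoeff_outdom ->.
exact: scale0r.
Qed.

Lemma malg_lift_is_linear G : linear (malg_lift G).
Proof.
move=> a p q; pose d := (msupp p `|` msupp q `|` msupp (a *: p + q))%fset.
rewrite !(@malg_liftEw _ d) ?fsubsetUr //; last 2 first.
- exact: fsubset_trans (fsubsetUr _ _) (fsubsetUl _ _).
- exact: fsubset_trans (fsubsetUl _ _) (fsubsetUl _ _).
rewrite scaler_sumr -big_split; apply: eq_bigr => k _.
by rewrite mcoeffD mcoeffZ scalerDl scalerA.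
Qed.

HB.instance Definition _ G :=
  GRing.isLinear.Build K poly_ring V *:%R (malg_lift G) (malg_lift_is_linear G).

Definition malg_var (i : I) : poly_ring := mkmalgU (ucm i) 1.

Definition cmonom_seq (k : {cmonom I}) : seq I :=
  flatten [seq nseq (k i) i | i <- finsupp k].

Lemma count_cmonom_seq k i : count_mem i (cmonom_seq k) = k i.
Proof.
rewrite count_flatten -map_comp sumnE big_map.
rewrite (eq_bigr (fun j => if j == i then k i else 0)%N) => [|j _] /=;
  last first.
  by rewrite count_nseq /=; case: eqP => [->|_]; rewrite ?mul1n ?mul0n.
rewrite -big_mkcond big_const_seq (count_uniq_mem i (fset_uniq _)).
by case: mdomP => _ //=; rewrite addn0.
Qed.

Lemma malg_varsE (s : seq I) : exists2 k : {cmonom I},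
  perm_eq (cmonom_seq k) s & \prod_(i <- s) malg_var i = mkmalgU k 1.
Proof.
exists (\big[mmul/mone]_(i <- s) ucm i).
  apply/allP => i _ /=; apply/eqP; rewrite count_cmonom_seq.
  elim: s => [|j s IH]; first by rewrite big_nil cm1.
  by rewrite big_cons cmM cmU IH.
elim: s => [|j s IH]; first by rewrite !big_nil.
rewrite !big_cons IH malgM_def fgmulUU mulr1; reflexivity.
Qed.

(** Invariance is asked only at the word [s], so [G] may depend on the order of letters elsewhere.
    This matters for [psi], which is well behaved only on monomials of even degree in the d_j and on
    the single d_i. *)
Lemma malg_lift_vars (G : seq I -> V) (s : seq I) :
  (forall s', perm_eq s' s -> G s' = G s) ->
  malg_lift (G \o cmonom_seq) (\prod_(i <- s) malg_var i) = G s.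
Proof.
move=> Gs; have [k ks ->] := malg_varsE s.
rewrite (malg_liftEw _ msuppU_le) big_seq_fset1 mcoeffUU scale1r; exact: Gs.
Qed.

End MonomialFunctional.

(** * The anti-commutator product of the commutative model *)

Section CommutativeModel.
Variables (K : fieldType) (P : comAlgType K).

Definition td_op (x y : P * P) : P * P := (x.1 * y.1 - x.2 * y.2, 0).

Variables t d : nat -> P.

Definition tdmonom (al J : seq nat) : P :=
  (\prod_(i <- al) t i) * \prod_(j <- J) d j.

Lemma mul_tdmonom_t i al J : t i * tdmonom al J = tdmonom (i :: al) J.
Proof. by rewrite /tdmonom big_cons mulrA. Qed.

Lemma mul_tdmonom_cherry i j al J :
  (t i * t j - d i * d j) * tdmonom al J =
    tdmonom [:: i, j & al] J - tdmonom al [:: i, j & J].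
Proof.
rewrite mulrBl -!mulrA !mul_tdmonom_t; congr (_ - _).
by rewrite /tdmonom !big_cons [d j * (_ * _)]mulrCA [LHS]mulrCA.
Qed.

End CommutativeModel.

(** * The operators T_i and D_ij on B^2, and the elements D^J - T^J *)

Section Variety.
Variables (K : fieldType) (B : lmodType K) (op : {bilinear B -> B -> B}).
Hypotheses (opC : commutative op) (tortken : minus_tortken op)
  (opAC : weak_right_commutative op).
Variable v : nat -> B.
Local Notation "x ** y" := (op x y) (at level 40, left associativity).
Local Notation assoc := (assoc op).

(** Stands in for membership in B^2: it holds for products and is stable under sums and
    differences. *)
Definition mul_commutes (u : B) := forall a b, a ** (b ** u) = b ** (a ** u).

Lemma mul_commutes_op a b : mul_commutes (a ** b).
Proof.
move=> c d; rewrite [c ** _]opC [d ** (a ** b)]opC opAC.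
by rewrite [_ ** d]opC [_ ** c]opC.
Qed.

Lemma mul_commutesB u w :
  mul_commutes u -> mul_commutes w -> mul_commutes (u - w).
Proof. by move=> uC wC a b; rewrite !linearBr uC wC. Qed.

Lemma mul_commutesD u w :
  mul_commutes u -> mul_commutes w -> mul_commutes (u + w).
Proof. by move=> uC wC a b; rewrite !linearDr uC wC. Qed.

(** a(wu) = a(uw) = u(aw) = (aw)u, with [a] arbitrary. *)
Lemma opA a w u : mul_commutes u -> mul_commutes w ->
  a ** (w ** u) = (a ** w) ** u.
Proof. by move=> uC wC; rewrite [w ** u]opC wC opC. Qed.

Lemma mul_commutes_assoc a b u : mul_commutes (assoc a b u).
Proof. by apply: mul_commutesB; apply: mul_commutes_op. Qed.

Definition act (s : seq nat) (u : B) : B := foldr (fun i => op (v i)) u s.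

Lemma mul_commutes_act s u : mul_commutes u -> mul_commutes (act s u).
Proof. by move=> uC; case: s => //= i s; apply: mul_commutes_op. Qed.

Lemma actB s u w : act s (u - w) = act s u - act s w.
Proof. by elim: s => //= i s ->; rewrite linearBr. Qed.

Lemma actD s u w : act s (u + w) = act s u + act s w.
Proof. by elim: s => //= i s ->; rewrite linearDr. Qed.

Lemma act_op s a u : mul_commutes u -> act s (a ** u) = a ** act s u.
Proof.
by move=> uC; elim: s => //= i s ->; apply: mul_commutes_act.
Qed.

Lemma act_mul s w u : mul_commutes u -> mul_commutes w ->
  act s (w ** u) = act s w ** u.
Proof. by move=> uC wC; rewrite opC act_op // opC. Qed.

Lemma perm_act s1 s2 u : mul_commutes u -> perm_eq s1 s2 -> act s1 u = act s2 u.
Proof.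
move=> uC; elim/perm_eq_ind: s1 s2 / => [//|? ? ? -> //|i s1 s2 _ /= -> //|].
by move=> i j s /=; apply: mul_commutes_act.
Qed.

(** For u in B^2, [assoc a b u] is D_ab u; thus D_ab commutes with the T_i. *)
Lemma act_assoc s a b u : mul_commutes u ->
  act s (assoc a b u) = assoc a b (act s u).
Proof.
by move=> uC; rewrite actB !act_op //; apply: mul_commutes_op.
Qed.

Lemma assocBr a b u w : assoc a b (u - w) = assoc a b u - assoc a b w.
Proof. by rewrite /Defs.assoc !linearBr /= opprD addrACA -opprD. Qed.

(* On B^2, D_ab D_cd = T_a T_b T_c T_d - tortken_term a b c d. *)
Definition tortken_term a b c d : B :=
  a ** (b ** (c ** d)) + c ** (d ** (a ** b)) - (a ** b) ** (c ** d).

(** This is the minus-Tortken identity at a, b, d, c, once each (a(bd))c is rewritten as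
    a(c(bd)). *)
Lemma tortken_termAC a b c d : tortken_term a b c d = tortken_term a c b d.
Proof.
have swap (x y z w p q : B) : p - q = - (x - y) + (z - w) ->
    z + y - p = x + w - q.
  rewrite opprB => /eqP; rewrite subr_eq => /eqP->.
  apply/eqP; rewrite subr_eq [_ + q]addrC addrA subrK addrACA.
  by rewrite [x + _]addrC subrK [w + _]addrC subrK addrC.
apply: swap; have := tortken a b d c.
rewrite /Defs.assoc !linearBl /= [d ** c]opC [d ** b]opC => ->.
rewrite [(_ ** (b ** d)) ** c]opC [c ** (a ** _)]mul_commutes_op.
rewrite [(_ ** (c ** d)) ** b]opC [b ** (a ** _)]mul_commutes_op.
by rewrite ![(_ ** d) ** _]opC ![(_ ** _) ** d]opC.
Qed.

Lemma assoc_assoc a b c d u : mul_commutes u ->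
  assoc a b (assoc c d u) =
    a ** (b ** (c ** (d ** u))) - tortken_term a b c d ** u.
Proof.
move=> uC; have opM := mul_commutes_op.
rewrite assocBr /Defs.assoc /tortken_term linearBl linearDl /=.
have -> : (a ** b) ** (c ** (d ** u)) = (c ** (d ** (a ** b))) ** u.
  by rewrite -(opA c) // -(opA d) // opM [_ ** (d ** u)]uC.
have -> : a ** (b ** ((c ** d) ** u)) = (a ** (b ** (c ** d))) ** u.
  by rewrite -(opA a) // -(opA b).
rewrite (opA (a ** b) uC (opM c d)) -addrA -opprD addrA.
by rewrite [c ** _ ** _ + _]addrC.
Qed.

Lemma assocC a b u : mul_commutes u -> assoc a b u = assoc b a u.
Proof. by move=> uC; rewrite /Defs.assoc uC [b ** a]opC. Qed.

(* The element D^J - T^J of B^2, as a telescoping sum: neither D^J nor T^J is *)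
(* an element of B by itself. On lists of odd length it is meaningful only   *)
(* for singletons, where it encodes psi (d_i) = v_i.                          *)
Fixpoint dcorr (J : seq nat) : B :=
  match J with
  | [::] => 0
  | [:: i] => v i
  | i :: j :: J' => assoc (v i) (v j) (dcorr J') - act J' (v i ** v j)
  end.

Lemma mul_commutes_dcorr J : ~~ odd (size J) -> mul_commutes (dcorr J).
Proof.
elim/seq_pair_ind: J => //= [_ a b|i j J _ _]; first by rewrite !linear0r.
apply: mul_commutesB; first exact: mul_commutes_assoc.
exact/mul_commutes_act/mul_commutes_op.
Qed.

(** Two pairs enter only through T_i T_j T_k T_l and [tortken_term], so j and k can be exchanged. *)
Lemma dcorr_cons4 i j k l J : ~~ odd (size J) ->
  dcorr [:: i, j, k, l & J] =
    v i ** (v j ** (v k ** (v l ** dcorr J)))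
      - (tortken_term (v i) (v j) (v k) (v l) ** dcorr J
         + act J (tortken_term (v i) (v j) (v k) (v l))).
Proof.
move=> even_J; have eC := mul_commutes_dcorr even_J.
have opM := mul_commutes_op.
rewrite /= assocBr assoc_assoc // -act_assoc // -addrA -opprD.
rewrite -(act_op J (v l)) // -(act_op J (v k)) // -addrA -!opprD -actD.
congr (_ - (_ + act J _)).
by rewrite /tortken_term /Defs.assoc addrAC.
Qed.

Lemma dcorr_swap s1 x y s2 : ~~ odd (size (s1 ++ x :: y :: s2)) ->
  dcorr (s1 ++ x :: y :: s2) = dcorr (s1 ++ y :: x :: s2).
Proof.
elim/seq_pair_ind: s1 => [|i|i j s1 IH] /=.
- rewrite negbK => even_s2.
  by rewrite assocC ?[v x ** v y]opC //; apply: mul_commutes_dcorr.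
(* The transposition straddles two pairs; even length provides a fourth letter. *)
- case: s2 => [|j s2] /=; first by [].
  rewrite !negbK => even_s2.
  rewrite [LHS]dcorr_cons4 // [RHS]dcorr_cons4 // tortken_termAC.
  by congr (_ ** _ - _); apply/mul_commutes_op.
- rewrite negbK => ev; rewrite IH //.
  rewrite (@perm_act _ (s1 ++ y :: x :: s2)) //; first exact: mul_commutes_op.
  by rewrite perm_cat2l (perm_catCA [:: x] [:: y] s2).
Qed.

Lemma perm_dcorr s1 s2 : ~~ odd (size s1) -> perm_eq s1 s2 ->
  dcorr s1 = dcorr s2.
Proof.
move=> ev p12.
(* Removing a letter changes the parity, so the induction runs under an arbitrary prefix, and the
   parity condition is put on the whole list. *)
suff [_ /(_ [::])] : size s1 = size s2 /\
    forall s, ~~ odd (size (s ++ s1)) -> dcorr (s ++ s1) = dcorr (s ++ s2).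
  exact.
elim/perm_eq_ind: s1 s2 / p12 {ev} => [//|s1 s2 s3|x s1 s2 _|x y s].
- move=> [sz12 H12] [sz23 H23]; split=> [|s ev]; first by rewrite sz12.
  by rewrite H12 // H23 // size_cat -sz12 -size_cat.
- move=> [sz12 H12]; split=> [/=|s]; first by rewrite sz12.
  by rewrite -!cat_rcons; apply: H12.
- by split=> // s0; apply: dcorr_swap.
Qed.

(** * The map psi on values of monomials *)

Variables (P : comAlgType K) (t d : nat -> P) (psi : {linear P -> B}).
Hypothesis psi_tdmonom : forall al J, ~~ odd (size J) ->
  psi (tdmonom t d al J) = act al (dcorr J).
Hypothesis psi_d : forall i, psi (d i) = v i.
Local Notation tdmonom := (tdmonom t d).

Lemma psi_t i : psi (t i) = 0.
Proof.
have -> : t i = tdmonom [:: i] [::] by rewrite /tdmonom big_seq1 big_nil mulr1.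
by rewrite psi_tdmonom //= linear0r.
Qed.

(* Even polynomials act on B^2, with t^al d^J acting as T^al D^J; here q
   behaves under psi like u under this action. *)
Definition represents (q : P) (u : B) : Prop :=
  mul_commutes u /\ forall al J, ~~ odd (size J) ->
    psi (q * tdmonom al J) = act al (dcorr J ** u + act J u).

Lemma represents_t q u i :
  represents q u -> represents (q * t i) (v i ** u).
Proof.
move=> [uC H]; split=> [|al J ev]; first exact: mul_commutes_op.
rewrite -mulrA mul_tdmonom_t H //= -act_op.
  by rewrite linearDr (act_op J _ uC) [_ ** (_ ** u)]uC.
by apply: mul_commutesD; [apply: mul_commutes_op|apply: mul_commutes_act].
Qed.

(** On B^2, t_i t_j - d_i d_j acts as T_i T_j - D_ij, which is multiplication by v_i v_j. *)
Lemma represents_cherry q u i j : represents q u ->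
  represents (q * (t i * t j - d i * d j)) ((v i ** v j) ** u).
Proof.
move=> [uC H]; split=> [|al J ev]; first exact: mul_commutes_op.
have [opM eC] := (mul_commutes_op, mul_commutes_dcorr ev).
rewrite -mulrA mul_tdmonom_cherry mulrBr raddfB /=.
rewrite !H ?negbK //=.
rewrite -(act_op al (v j)) -1?(act_op al (v i)) -?actB; last 2 first.
- exact: mul_commutes_op.
- by apply: mul_commutesD; [apply: mul_commutes_op|apply: mul_commutes_act].
congr (act al _); rewrite !linearDr [in X in _ - X]linearBl /=.
rewrite opprD addrACA subrr addr0 [Defs.assoc _ _ _ _ ** u]linearBl /=.
rewrite -(opA (v i)) // -(opA (v j)) // -(opA (v i ** v j)) // -act_mul //.
by rewrite opprB addrA opprB addrC addrA subrK [_ ** (_ ** u)]uC.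
Qed.

(** The case q = 1 of the previous computation, done separately because in general no element of B
    represents 1. *)
Lemma represents_cherry0 i j :
  represents (t i * t j - d i * d j) (v i ** v j).
Proof.
split=> [|al J ev]; first exact: mul_commutes_op.
have [opM eC] := (mul_commutes_op, mul_commutes_dcorr ev).
rewrite mul_tdmonom_cherry raddfB /=.
rewrite !psi_tdmonom ?negbK //=.
rewrite -(act_op al (v j)) // -(act_op al (v i)) -?actB; last first.
  exact: mul_commutes_op.
congr (act al _).
by rewrite /Defs.assoc opprB addrA opprB addrC addrA subrK [dcorr J ** _]opC.
Qed.

Local Notation eval_td :=
  (eval_monomial (K := K) (@td_op K P) (fun i => (t i, d i))).
Local Notation eval_B := (eval_monomial (K := K) op v).

Lemma eval_td_Mul m1 m2 : eval_td (Mul m1 m2) =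
  ((eval_td m1).1 * (eval_td m2).1 - (eval_td m1).2 * (eval_td m2).2, 0).
Proof. by []. Qed.

Definition is_product m := if m is Mul _ _ then true else false.

(** Products have second component 0, so the d_i contribute only when two variables are multiplied;
    in all other cases [opA] splits multiplication by a product into two successive
    multiplications. *)
Lemma represents_mul m q u : is_product m -> represents q u ->
  represents (q * (eval_td m).1) (eval_B m ** u).
Proof.
elim: m q u => [//|[i|m11 m12] IH1 [j|m21 m22] IH2] q u _ qu;
  have uC := qu.1; rewrite eval_td_Mul.
- exact: represents_cherry.
- rewrite [_.2 in X in _ - X]/= mulr0 subr0 mulrA -opA //; last first.
    exact: mul_commutes_op.
  by rewrite uC; apply/IH2/represents_t.
- rewrite mul0r subr0 mulrA /= [_ ** v j]opC -opA //; last first.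
    exact: mul_commutes_op.
  exact/represents_t/IH1.
- rewrite mul0r subr0 mulrA [eval_B (Mul _ (Mul _ _))]opC -opA //; last first.
    exact: mul_commutes_op.
  exact/IH2/IH1.
Qed.

Lemma represents_eval m : is_product m -> represents (eval_td m).1 (eval_B m).
Proof.
elim: m => [//|[i|m11 m12] IH1 [j|m21 m22] IH2] _; rewrite eval_td_Mul.
- exact: represents_cherry0.
- rewrite mulr0 subr0 mulrC.
  exact/represents_t/IH2.
- rewrite mul0r subr0 /= [_ ** v j]opC.
  exact/represents_t/IH1.
- rewrite mul0r subr0 [eval_B _]opC.
  exact/represents_mul/IH1.
Qed.

Lemma psi_eval m : psi (eval_td m).1 + psi (eval_td m).2 = eval_B m.
Proof.
case: m => [i|m1 m2]; first by rewrite /= psi_t psi_d add0r.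
have [_ /(_ [::] [::] isT)] := @represents_eval (Mul m1 m2) isT.
rewrite /tdmonom !big_nil !mulr1 /= linear0l add0r => ->.
by rewrite raddf0 addr0.
Qed.

End Variety.

(** * The bicommutative algebra P * P *)

Section HalfProduct.
Variables (K : fieldType) (P : comAlgType K).

Definition half_mul (x y : P * P) : P * P :=
  (2^-1 *: ((x.1 + x.2) * (y.1 - y.2)), 0).

Lemma half_mul_bilinear : bilinear_for *:%R *:%R half_mul.
Proof.
split=> [y|x] a u w; apply/pair_equal_spec; split=> /=;
  rewrite ?scaler0 ?addr0 //.
- by rewrite addrACA -scalerDr mulrDl -scalerAl scalerDr !scalerA mulrC.
- rewrite opprD addrACA -scalerBr mulrDr -scalerAr scalerDr !scalerA.
  by rewrite [a * _]mulrC.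
Qed.

HB.instance Definition _ := bilinear_isBilinear.Build K _ _ _ _ _ half_mul
  half_mul_bilinear.

(** A product has second component 0, so a(bc) has first component (a1 + a2)(b1 + b2)(c1 - c2)/4,
    symmetric in a and b; (ab)c is similar. *)
Lemma half_mul_bicommutative : bicommutative half_mul.
Proof.
split=> a b c; rewrite /half_mul /= ?subr0 ?addr0; congr (_, _).
  by rewrite -!scalerAr mulrCA.
by rewrite -!scalerAl mulrAC.
Qed.

Lemma anticommutator_half_mul x y : 2 != 0 :> K ->
  anticommutator half_mul x y = td_op x y.
Proof.
move=> K2; rewrite /anticommutator /half_mul /td_op.
apply/pair_equal_spec; split=> /=; last exact: addr0.
rewrite -scalerDr; set p := _ + _.
have -> : p = (x.1 * y.1 - x.2 * y.2) *+ 2 by rewrite /p; ring.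
by rewrite -scaler_nat scalerA mulVf ?scale1r.
Qed.

End HalfProduct.

Lemma linear_fglift (K : fieldType) (T : choiceType) (U V : lmodType K)
    (g : {linear U -> V}) (h : T -> U) (h' : T -> V) (f : {freeg T / K}) :
  (forall x, g (h x) = h' x) -> g (fglift h f) = fglift h' f.
Proof.
move=> gh; rewrite -[f]Freeg_dom !fglift_Freeg /prelift raddf_sum.
by apply: eq_bigr => x _; rewrite /= linearZ /= gh.
Qed.

(** * Construction of psi on polynomials in the t_i and d_i *)

Section PolynomialModel.
Variables (K : fieldType) (B : lmodType K) (op : {bilinear B -> B -> B}).
Hypotheses (opC : commutative op) (tortken : minus_tortken op)
  (opAC : weak_right_commutative op).
Variable v : nat -> B.

Local Notation P := {malg K[{cmonom (nat + nat)%type}]}.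

Definition tvar (i : nat) : P := malg_var K (inl i).
Definition dvar (i : nat) : P := malg_var K (inr i).

Definition left_part (x : (nat + nat)%type) :=
  if x is inl i then Some i else None.
Definition right_part (x : (nat + nat)%type) :=
  if x is inr i then Some i else None.

Definition psi : P -> B := malg_lift
  ((fun s => act op v (pmap left_part s) (dcorr op v (pmap right_part s)))
     \o @cmonom_seq (nat + nat)%type).

HB.instance Definition _ := GRing.Linear.on psi.

Lemma psi_tdmonom al J : ~~ odd (size J) ->
  psi (tdmonom tvar dvar al J) = act op v al (dcorr op v J).
Proof.
move=> ev; have lr (s1 s2 : seq nat) :
    (pmap left_part (map inl s1 ++ map inr s2) = s1) *
    (pmap right_part (map inl s1 ++ map inr s2) = s2).
  split; rewrite pmap_cat; elim: s1 => [|i s1 IH] /=; rewrite ?IH //;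
    by elim: s2 => //= j s2 ->.
have -> : tdmonom tvar dvar al J =
    \prod_(x <- map inl al ++ map inr J) malg_var K x.
  by rewrite big_cat !big_map.
rewrite /psi malg_lift_vars /= ?lr // => s' s's.
have := (perm_pmap left_part s's, perm_pmap right_part s's).
rewrite !lr => -[pl pr].
rewrite -(perm_dcorr opC tortken opAC v ev) 1?perm_sym //.
by apply: perm_act => //; exact: mul_commutes_dcorr.
Qed.

Lemma psi_dvar i : psi (dvar i) = v i.
Proof.
have -> : dvar i = \prod_(x <- [:: inr i]) malg_var K x by rewrite big_seq1.
by rewrite /psi malg_lift_vars //= => s /perm_small_eq->.
Qed.

End PolynomialModel.

Theorem theorem2p2 (K : fieldType) (charK : [pchar K] =i pred0) (f : napoly K) :
  (forall (A : lmodType K) (mul : {bilinear A -> A -> A}),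
     bicommutative mul -> satisfies (anticommutator mul) f) ->
  forall (B : lmodType K) (op : {bilinear B -> B -> B}),
    commutative op -> minus_tortken op -> weak_right_commutative op ->
    satisfies op f.
Proof.
move=> f_id B op opC tortken opAC v.
have K2 : 2 != 0 :> K by have := charK 2; rewrite !inE /= => ->.
pose P : comAlgType K := {malg K[{cmonom (nat + nat)%type}]}.
pose td i : P * P := (tvar K i, dvar K i).
(* The second component is needed for variables: psi (t_i) = 0 and psi (d_i) = v_i, so (t_i, d_i)
   goes to v_i. *)
pose sum_psi : {linear (P * P)%type -> B} :=
  (psi op v \o fst) \+ (psi op v \o snd).
have := f_id _ (@half_mul K P) (@half_mul_bicommutative K P) td.
move=> /(congr1 sum_psi); rewrite linear0 => <-.
apply/esym/linear_fglift => m.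
have -> : eval_monomial (anticommutator (@half_mul K P)) td m =
    eval_monomial (@td_op K P) td m.
  by elim: m => //= m1 -> m2 ->; rewrite anticommutator_half_mul.
apply: psi_eval => // [al J|i]; [exact: psi_tdmonom|exact: psi_dvar].
Qed.
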